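(* Let $m_1\ge 3$, $m_2\ge 3$ and $3\le h<m_1m_2$. Then the puzzle graph $puz[P(h;m_1,m_2)]$ of the $m_1\times m_2$ parallelogram board with $h$ holes is maximally connected, that is, it has one connected component containing all non-isolated configurations.
   Context: Hexagons of the regular hexagonal tessellation of the plane are identified with points of $\mathbb{Z}^2$; two hexagons are adjacent (share an edge) iff their difference is one of $\pm(1,0),\pm(0,1),\pm(1,1)$. A board $B$ is a finite set of hexagons (positions). The $m_1\times m_2$ parallelogram board ($m_1$ columns, $m_2$ rows) is $P(m_1,m_2)=\{0,\dots,m_1-1\}\times\{0,\dots,m_2-1\}$. $B(h)$ denotes the board $B$ with $h$ holes: a configuration of $B(h)$ is a placement of $t=|B|-h$ tiles with distinct labels $1,\dots,t$ on distinct positions of $B$; the $h$ unoccupied positions are the holes (unlabeled; adjacent holes are counted separately). A slide moves a tile from its position $p$ to a hole $q$ adjacent to $p$, and is permitted iff there is another hole $r$ that is adjacent to both $p$ and $q$. The puzzle graph $puz[B(h)]$ has the configurations of $B(h)$ as vertices, with an edge between two configurations whenever one can be obtained from the other by one slide. A configuration is non-isolated if at least one slide is possible from it. $puz[B(h)]$ is maximally connected if there is at least one non-isolated configuration and all non-isolated configurations lie in a single connected component. $P(h;m_1,m_2)$ is the board $P(m_1,m_2)$ with $h$ holes. *)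

(* Defs.v *)
From mathcomp Require Import all_boot all_order all_algebra.
From mathcomp Require Import finmap.

Set Implicit Arguments.
Unset Strict Implicit.
Unset Printing Implicit Defensive.

Import GRing.Theory.
Local Open Scope ring_scope.
Local Open Scope fset_scope.

Definition hexagon : Type := (int * int)%type.

Definition hex_adj (p q : hexagon) : bool :=
  q - p \in [:: (1, 0); (-1, 0); (0, 1); (0, -1); (1, 1); (-1, -1)].

Definition parallelogram (m1 m2 : nat) : {fset hexagon} :=
  [fset (i%:Z, j%:Z) | i in iota 0 m1, j in iota 0 m2].

Section Puzzle.
Variables (B : {fset hexagon}) (h : nat).

(* The position of each tile; the label k + 1 is encoded by k.  The number of
   tiles is a truncated subtraction, so this is only meaningful for
   h <= #|` B|. *)
Definition config : finType :=
  {c : {ffun 'I_(#|` B| - h) -> B} | injectiveb c}.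

Definition hole (c : config) (p : B) : bool := p \notin codom (val c).

(* No disequality of q and r is needed: hex_adj is irreflexive. *)
Definition slide (c c' : config) : bool :=
  [exists i, [&& [forall j, (j != i) ==> (val c' j == val c j)],
                 hole c (val c' i),
                 hex_adj (val (val c i)) (val (val c' i)) &
                 [exists r : B, [&& hole c r,
                                    hex_adj (val (val c i)) (val r) &
                                    hex_adj (val (val c' i)) (val r)]]]].

Definition puz : rel config := fun c c' => slide c c' || slide c' c.

Definition non_isolated (c : config) : Prop := exists c', slide c c'.

Definition maximally_connected : Prop :=
  (exists c, non_isolated c) /\
  (forall c c', non_isolated c -> non_isolated c' -> connect puz c c').

End Puzzle.

(* Main.v *)
Require Import Defs.
From mathcomp Require Import all_boot all_order all_algebra.
From mathcomp Require Import finmap.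
From mathcomp Require Import fingroup perm.
From mathcomp Require Import zify.

(** Call a triangle three pairwise adjacent positions.  If two positions of a
triangle are vacant, the tile on the third may go to either of them; so a
configuration is non-isolated exactly when some triangle has two holes and one
tile.  Everything is done with triangles that are entirely vacant.

Gathering.  A pair of adjacent holes can be pivoted through the triangles of
the board, and it is led this way to a third hole, with which it forms a vacant
triangle ([linked_gather]).  A vacant triangle can then be flipped over any side that it
shares with another triangle ([linked_flip]), hence be led to any prescribed
triangle ([linked_vacate]).  It remains to show that the tiles can be permuted at will
while the same triangle is vacant before and after, and for that it suffices
to exchange any two positions x and y outside the triangle, an operation that
[swappable] expresses.

Exchanges.  Swappability is an equivalence relation on the positions outside a
vacant triangle, and flipping the triangle transports it: the tile that
the flipped triangle jumps over moves from one side to the other, all others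
stay.  Suppose that for each triangle the positions facing its sides are
swappable with one another.  Let x be any position, and walk with triangles
from one that contains x to a given one: at each flip the position just left
faces the new triangle, so that x stays swappable with a facing position
([swappable_flank]).  Hence all positions are swappable ([swappable_all]).

The local exchange.  A triangle and two facing positions always lie in a
3 x 3 square of the board, where the centre is surrounded by a ring of six
positions, with two further corners off the ring.  Without a corner the cyclic
order of the tiles on the ring would be invariant; the corner allows one tile
to step off and another to take its place ([corner_word]).  The exchanges
required follow from this one by symmetry and conjugation, and a computation
confirms it for all the triangles of the square ([flanks_checked]).

With more than three holes nothing changes: moving a hole instead of a tile
does nothing to the configuration, so only the three holes of the vacant
triangle are ever looked at. *)

Set Implicit Arguments.
Unset Strict Implicit.
Unset Printing Implicit Defensive.

(** * Configurations and vacant triangles *)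

Section Board.
Variables (B : {fset hexagon}) (h : nat).
Implicit Types (a b p q r x y z : B) (c : config B h) (g : {perm B}).

Definition adj p q : bool := hex_adj (val p) (val q).
Definition tri p q r : bool := [&& adj p q, adj q r & adj p r].

Lemma hex_adj_sym : symmetric hex_adj.
Proof.
pose directions : seq (int * int) :=
  [:: (1, 0); (-1, 0); (0, 1); (0, -1); (1, 1); (-1, -1)]%R.
have opp (v : int * int) : v \in directions -> (- v)%R \in directions.
  by rewrite !inE => /or4P[/eqP->|/eqP->|/eqP->|/or3P[] /eqP->].
by move=> p q; rewrite /hex_adj; apply/idP/idP => /opp; rewrite GRing.opprB.
Qed.

Lemma adjC p q : adj p q = adj q p.
Proof. exact: hex_adj_sym. Qed.

Lemma adjxx p : adj p p = false.
Proof. by rewrite /adj /hex_adj GRing.subrr. Qed.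

Lemma adj_neq p q : adj p q -> p != q.
Proof. by case: eqVneq => // ->; rewrite adjxx. Qed.

Lemma triC p q r : tri p q r = tri q p r.
Proof. by rewrite /tri (adjC q p); case: adj; case: adj; case: adj. Qed.

Lemma triR p q r : tri p q r = tri q r p.
Proof. by rewrite /tri (adjC r p) (adjC q p); case: adj; case: adj; case: adj. Qed.

Lemma displace_subproof g c : injectiveb [ffun i => g (val c i)].
Proof.
apply/injectiveP => i j; rewrite !ffunE => /perm_inj.
by have /injectiveP := valP c; apply.
Qed.

(** Slides are handled as permutations of the positions, so that words in slides
compose and can be conjugated. *)
Definition displace g c : config B h :=
  Sub [ffun i => g (val c i)] (displace_subproof g c).

Lemma displaceE g c i : val (displace g c) i = g (val c i).
Proof. by rewrite /displace SubK ffunE. Qed.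

Lemma config_inj c c' : (forall i, val c i = val c' i) -> c = c'.
Proof. by move=> E; apply/val_inj/ffunP. Qed.

Lemma displaceM g g' c : displace (g * g')%g c = displace g' (displace g c).
Proof. by apply: config_inj => i; rewrite !displaceE permM. Qed.

Lemma displace1 c : displace 1%g c = c.
Proof. by apply: config_inj => i; rewrite !displaceE perm1. Qed.

Lemma holeP c p : reflect (forall i, val c i <> p) (hole c p).
Proof.
apply: (iffP idP) => [/negP hp i E|hp]; first by apply: hp; rewrite -E codom_f.
by apply/negP => /codomP[i E]; case: (hp i).
Qed.

Lemma hole_displace g c p : hole (displace g c) (g p) = hole c p.
Proof.
apply/holeP/holeP => hp i; move: (hp i); rewrite displaceE.
  by move=> H E; apply: H; rewrite E.
by move=> H /perm_inj.
Qed.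

Lemma hole_tperm c x y p :
  p != x -> p != y -> hole (displace (tperm x y) c) p = hole c p.
Proof.
move=> nx ny.
by rewrite -{1}(tpermD (z := p) (x := x) (y := y)) ?hole_displace // eq_sym.
Qed.

Lemma hole_tpermL c x y : hole (displace (tperm x y) c) x = hole c y.
Proof. by rewrite -{2}(tpermR x y) hole_displace. Qed.

Lemma hole_tpermR c x y : hole (displace (tperm x y) c) y = hole c x.
Proof. by rewrite -{2}(tpermL x y) hole_displace. Qed.

(** This is why holes need no labels, and why holes beyond the three of a triangle
can be treated as if they were tiles. *)
Lemma displace_tperm_holes c x y : hole c x -> hole c y -> displace (tperm x y) c = c.
Proof.
move=> /holeP hx /holeP hy; apply: config_inj => i; rewrite displaceE tpermD //.
  by apply/eqP => E; apply: (hx i).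
by apply/eqP => E; apply: (hy i).
Qed.

Definition linked : rel (config B h) := connect (@puz B h).

Lemma linked_sym : symmetric linked.
Proof. by apply: sym_connect_sym => c c'; rewrite /puz orbC. Qed.

Lemma linked_trans : transitive linked.
Proof. exact: connect_trans. Qed.

Lemma linked_refl : reflexive linked.
Proof. exact: connect0. Qed.

(** When [p] is a hole as well, the exchange leaves the configuration unchanged. *)
Lemma linked_slide c p q r :
  tri p q r -> hole c q -> hole c r -> linked c (displace (tperm p q) c).
Proof.
move=> /and3P[pq qr pr] hq hr.
have [hp|] := boolP (hole c p); first by rewrite displace_tperm_holes ?linked_refl.
rewrite negbK => /codomP[i Ei]; apply/connect1/orP; left.
apply/existsP; exists i; rewrite displaceE -Ei tpermL hq.
have exr : [exists r : B, [&& hole c r, hex_adj (val p) (val r)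
                                      & hex_adj (val q) (val r)]].
  by apply/existsP; exists r; apply/and3P; split.
apply/and4P; split=> //.
apply/forallP => j; apply/implyP => nij; rewrite displaceE tpermD //; last first.
  by apply/eqP => E; move/holeP: hq => /(_ j); apply.
apply: contraNneq nij => E; apply/eqP; have /injectiveP := valP c; apply.
by rewrite -E.
Qed.

Definition vacant a b z c := [&& hole c a, hole c b & hole c z].

(** The vacant triangle flips over its side [b z]: the tile on [d] goes to [a] in
two slides, by way of [b]. *)
Lemma linked_flip c a b z d :
  tri a b z -> tri d b z -> vacant a b z c -> linked c (displace (tperm a d) c).
Proof.
move=> tabz tdbz /and3P[ha hb hz].
have [->|nad] := eqVneq a d; first by rewrite tperm1 displace1 linked_refl.
have L1 : linked c (displace (tperm d b) c) by exact: linked_slide tdbz hb hz.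
have /and3P[db bz dz] := tdbz; have /and3P[ab _ az] := tabz.
apply: linked_trans L1 _.
have -> : displace (tperm a d) c = displace (tperm b a) (displace (tperm d b) c).
  apply: config_inj => i; rewrite !displaceE.
  have na : val c i != a by apply/eqP => E; move/holeP: ha => /(_ i).
  have nb : val c i != b by apply/eqP => E; move/holeP: hb => /(_ i).
  have [->|nd] := eqVneq (val c i) d; first by rewrite tpermL tpermR tpermL.
  by rewrite !tpermD // eq_sym.
apply: (@linked_slide _ _ _ z); first by rewrite -triC.
  by rewrite hole_tperm // ?adj_neq.
by rewrite hole_tperm // eq_sym adj_neq.
Qed.

Lemma vacant_flip c a b z d :
  tri a b z -> tri d b z -> vacant a b z c -> vacant d b z (displace (tperm a d) c).
Proof.
move=> /and3P[ab _ az] /and3P[db bz dz] /and3P[ha hb hz].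
apply/and3P; split; first by rewrite hole_tpermR.
  by rewrite hole_tperm // eq_sym adj_neq.
by rewrite hole_tperm // eq_sym adj_neq.
Qed.

(** Transpositions generate all permutations of the tiles around a vacant triangle,
and a flip of the triangle turns them into transpositions again. *)
Definition swappable a b z x y :=
  forall c, vacant a b z c -> linked c (displace (tperm x y) c).

Lemma vacantC a b z c : vacant a b z c = vacant b a z c.
Proof. by rewrite /vacant andbCA. Qed.

Lemma vacantR a b z c : vacant a b z c = vacant b z a c.
Proof. by rewrite /vacant; case: hole; case: hole; case: hole. Qed.

Lemma swappableC a b z x y : swappable a b z x y -> swappable b a z x y.
Proof. by move=> H c; rewrite vacantC; apply: H. Qed.

Lemma swappableR a b z x y : swappable a b z x y -> swappable b z a x y.
Proof. by move=> H c; rewrite -vacantR; apply: H. Qed.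

Lemma swappable_sym a b z x y : swappable a b z x y -> swappable a b z y x.
Proof. by move=> H c; rewrite tpermC; apply: H. Qed.

Lemma swappable_refl a b z x : swappable a b z x x.
Proof. by move=> c _; rewrite tperm1 displace1 linked_refl. Qed.

Lemma vacant_tperm a b z x y c :
  x \notin [:: a; b; z] -> y \notin [:: a; b; z] ->
  vacant a b z (displace (tperm x y) c) = vacant a b z c.
Proof.
rewrite !inE !negb_or => /and3P[xa xb xz] /and3P[ya yb yz].
by rewrite /vacant !hole_tperm // eq_sym.
Qed.

(** The transposition of [x] and [w] is conjugate to that of [x] and [y] under
that of [y] and [w]; the side conditions keep the triangle vacant meanwhile. *)
Lemma swappable_trans a b z x y w :
  x \notin [:: a; b; z] -> y \notin [:: a; b; z] -> w \notin [:: a; b; z] ->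
  swappable a b z x y -> swappable a b z y w -> swappable a b z x w.
Proof.
move=> hx hy hw Sxy Syw.
have [->//|nxy] := eqVneq x y.
have [<-|nxw] := eqVneq x w; first exact: swappable_refl.
move=> c vc.
have -> : tperm x w = (tperm y w * tperm x y * tperm y w)%g.
  rewrite -[in LHS](tpermL y w) -[x in LHS](@tpermD _ y w x) 1?eq_sym //.
  by rewrite -tpermJ /conjg tpermV mulgA.
rewrite !displaceM; apply: (linked_trans (Syw _ vc)).
apply: linked_trans (Sxy _ _) (Syw _ _); rewrite ?vacant_tperm //.
Qed.

(** Flip the triangle from [d b z] to [a b z], exchange there, and flip back; the
flips are the same transposition, so the result is a conjugate. *)
Lemma swappable_flip a b z d x y :
  tri a b z -> tri d b z ->
  x \notin [:: a; b; z] -> y \notin [:: a; b; z] ->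
  swappable a b z x y -> swappable d b z (tperm a d x) (tperm a d y).
Proof.
move=> ta td hx hy S c vc.
have v1 : vacant a b z (displace (tperm a d) c) by rewrite tpermC vacant_flip.
have L1 : linked c (displace (tperm a d) c).
  by rewrite tpermC; apply: linked_flip td ta vc.
apply: (linked_trans L1); apply: (linked_trans (S _ v1)).
rewrite -tpermJ /conjg tpermV mulgA !displaceM.
by apply: linked_flip ta td _; rewrite vacant_tperm.
Qed.

End Board.

(** * From local exchanges to maximal connectedness *)

Section Connectedness.
Variables (B : {fset hexagon}) (h : nat).
Implicit Types (a b d e p q r x y z : B) (c : config B h).

(** The positions facing a side of the triangle. *)
Definition flank a b z d : bool :=
  (d \notin [:: a; b; z]) &&
  [|| adj d a && adj d b, adj d b && adj d z | adj d z && adj d a].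

(** Connectedness under flips, put as an induction principle: a predicate that
ignores the order of the vertices and survives flips spreads from one triangle
to all.  This spares talking about paths of triangles. *)
Definition triangles_connected : Prop :=
  forall P : B -> B -> B -> Prop,
    (forall a b z, P a b z -> P b a z) ->
    (forall a b z, P a b z -> P b z a) ->
    (forall a b z d, tri a b z -> tri d b z -> P a b z -> P d b z) ->
  forall a b z a' b' z', tri a b z -> tri a' b' z' -> P a b z -> P a' b' z'.

Definition triangles_cover : Prop := forall x : B, exists b z, tri x b z.

Definition flanks_swappable : Prop := forall a b z d e,
  tri a b z -> flank a b z d -> flank a b z e -> swappable h a b z d e.

Lemma flankC a b z d : flank a b z d = flank b a z d.
Proof.
rewrite /flank !inE orbCA; congr (_ && _).
by case: (adj d a); case: (adj d b); case: (adj d z).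
Qed.

Lemma flankR a b z d : flank a b z d = flank b z a d.
Proof.
rewrite /flank !inE orbC -orbA; congr (_ && _).
by case: (adj d a); case: (adj d b); case: (adj d z).
Qed.

Lemma flank_tri a b z d : tri a b z -> tri d b z -> d != a -> flank a b z d.
Proof.
move=> tabz /and3P[db bz dz] da.
by rewrite /flank !inE !negb_or da !adj_neq // db dz !orbT.
Qed.

Hypothesis Tconn : triangles_connected.
Hypothesis Tcover : triangles_cover.
Hypothesis Fswap : flanks_swappable.

(** By induction along flips, starting from a triangle that contains [x].  In the
induction, triangles containing [x] are accepted; the first time that the
triangle leaves [x], it is [x] itself that faces it. *)
Lemma swappable_flank a b z x : tri a b z -> x \notin [:: a; b; z] ->
  exists2 d, flank a b z d & swappable h a b z x d.
Proof.
move=> tabz xN.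
pose P a b z := x \in [:: a; b; z] \/
  exists2 d, flank a b z d & swappable h a b z x d.
suff [xin|//] : P a b z by rewrite xin in xN.
have [b0 [z0 t0]] := Tcover x.
apply: (Tconn (P := P) _ _ _ t0 tabz); last by left; rewrite inE eqxx.
- move=> a' b' z' [xin|[d Fd Sd]]; [left|right].
    by move: xin; rewrite !inE orbCA.
  by exists d; [rewrite flankC | exact: swappableC].
- move=> a' b' z' [xin|[d Fd Sd]]; [left|right].
    by move: xin; rewrite !inE orbC -orbA.
  by exists d; [rewrite -flankR | exact: swappableR].
move=> a1 b1 z1 d t1 t2 P1; rewrite /P.
have [<-//|nad] := eqVneq a1 d.
have [xin|xN2] := boolP (x \in [:: d; b1; z1]); [by left|right].
exists a1; first exact: flank_tri t2 t1 nad.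
have [xin1|xN1] := boolP (x \in [:: a1; b1; z1]).
  suff -> : x = a1 by apply: swappable_refl.
  by move: xin1 xN2; rewrite !inE; case: eqVneq => //= _ ->; rewrite orbT.
case: P1 => [|[e Fe Se]]; first by rewrite (negPf xN1).
have Fd : flank a1 b1 z1 d by apply: flank_tri; rewrite // eq_sym.
have /andP[eN _] := Fe; have /andP[dN _] := Fd.
have Sd := swappable_trans xN1 eN dN Se (Fswap t1 Fe Fd).
(* The tile that faced the old triangle on [d] now faces the new one on [a1]. *)
have := swappable_flip t1 t2 xN1 dN Sd.
rewrite tpermR tpermD //.
  by move: xN1; rewrite inE negb_or eq_sym => /andP[].
by move: xN2; rewrite inE negb_or eq_sym => /andP[].
Qed.

Lemma swappable_all a b z x y : tri a b z ->
  x \notin [:: a; b; z] -> y \notin [:: a; b; z] -> swappable h a b z x y.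
Proof.
move=> t xN yN; have [d Fd Sd] := swappable_flank t xN.
have [e Fe Se] := swappable_flank t yN.
have /andP[eN _] := Fe; have /andP[dN _] := Fd.
apply: (swappable_trans xN dN yN Sd).
by apply: (swappable_trans dN eN yN (Fswap t Fd Fe) (swappable_sym Se)).
Qed.

(** One exchange brings a tile to its goal without moving those that are already
there. *)
Lemma linked_same_vacancy a b z c c' : tri a b z ->
  vacant a b z c -> vacant a b z c' -> linked c c'.
Proof.
move=> t; have [n] := ubnP #|[set i | val c i != val c' i]|.
elim: n c => // n IHn c; rewrite ltnS => le_n vc vc'.
have vN c0 i : vacant a b z c0 -> val c0 i \notin [:: a; b; z].
  move=> /and3P[/holeP ha /holeP hb /holeP hz].
  by rewrite !inE !negb_or; apply/and3P; split; apply/eqP.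
have [E|[i]] := set_0Vmem [set i | val c i != val c' i].
  rewrite (_ : c = c') ?linked_refl //; apply: config_inj => i.
  by apply/eqP/negbNE/negP => ni; have := in_set0 i; rewrite -E inE ni.
rewrite inE => nei; set c1 := displace (tperm (val c i) (val c' i)) c.
have L1 : linked c c1 by apply: (swappable_all t) => //; apply: vN.
apply: linked_trans L1 (IHn c1 _ _ vc'); last by rewrite vacant_tperm // vN.
apply: leq_trans le_n; apply/proper_card/properP; split; last first.
  by exists i; rewrite !inE ?nei // displaceE tpermL eqxx.
apply/subsetP => j; rewrite !inE displaceE; apply: contraNN => /eqP E.
have /injectiveP inj := valP c; have /injectiveP inj' := valP c'.
rewrite tpermD ?E //; apply: contraNneq nei.
  by rewrite -E => /inj ->; rewrite E.
by move=> /inj' ->; rewrite E.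
Qed.

Lemma linked_vacate a b z a' b' z' c : tri a b z -> tri a' b' z' ->
  vacant a b z c -> exists2 c', linked c c' & vacant a' b' z' c'.
Proof.
move=> t t' vc.
pose P a b z := forall c, vacant a b z c ->
  exists2 c', linked c c' & vacant a' b' z' c'.
suff Pt : P a b z by apply: Pt.
apply: (Tconn (P := P) _ _ _ t' t) => {t vc c a b z}.
- by move=> a b z Pt c; rewrite vacantC; apply: Pt.
- by move=> a b z Pt c; rewrite -vacantR; apply: Pt.
- move=> a b z d t1 t2 Pt c vc.
  have [c1 L1 v1] := Pt _ (vacant_flip t2 t1 vc).
  by exists c1 => //; apply: linked_trans L1; apply: linked_flip t2 t1 vc.
by move=> c vc; exists c; rewrite ?linked_refl.
Qed.

(** By induction along flips, starting from a triangle that contains the third hole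
[x].  If [x] lies outside the triangle, the pair is first pivoted to the side
shared with the neighbour that is nearer to [x]; [x] stays a hole, as the slide
does not concern it. *)
Lemma linked_gather q r w x c : tri q r w ->
  x \notin [:: q; r] -> hole c q -> hole c r -> hole c x ->
  exists a b z c', [/\ tri a b z, linked c c' & vacant a b z c'].
Proof.
move=> t; have [b0 [z0 t0]] := Tcover x.
pose Q c := exists a b z c', [/\ tri a b z, linked c c' & vacant a b z c'].
(* Whichever side is vacant, provided that [x] is not one of its ends. *)
pose P a b z := tri a b z -> forall c, hole c x ->
  [\/ [&& hole c a, hole c b & x \notin [:: a; b]],
      [&& hole c b, hole c z & x \notin [:: b; z]] |
      [&& hole c z, hole c a & x \notin [:: z; a]]] -> Q c.
suff Pt : P q r w.
  by move=> xN hq hr hx; apply: (Pt t c hx); constructor 1; rewrite hq hr.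
apply: (Tconn (P := P) _ _ _ t0 t).
- move=> a b z Pt t1 d hx H; apply: Pt => //; first by rewrite triC.
  rewrite !inE !negb_or in H *.
  by case: H => /and4P[-> -> -> ->]; [constructor 1|constructor 3|constructor 2].
- move=> a b z Pt t1 d hx H; apply: Pt => //; first by rewrite triR.
  by case: H => /and3P[h1 h2 h3];
    [constructor 2|constructor 3|constructor 1]; rewrite h1 h2 h3.
- move=> a b z d t1 t2 Pt _ c1 hx H.
  have reach c2 : linked c1 c2 -> hole c2 x -> hole c2 b -> hole c2 z ->
      x \notin [:: b; z] -> Q c1.
    move=> L h1 h2 h3 xN; have [|a' [b' [z' [c' [t' L' v']]]]] := Pt t1 c2 h1.
      by constructor 2; rewrite h2 h3.
    by exists a', b', z', c'; split=> //; apply: linked_trans L L'.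
  have [xin|xN] := boolP (x \in [:: d; b; z]).
    exists d, b, z, c1; split; rewrite ?linked_refl //.
    case: H => /and3P[h1 h2]; move: xin hx; rewrite /vacant h1 h2 !inE /= ?andbT;
      by case/or3P=> /eqP->; rewrite ?eqxx ?orbT.
  have [nd nb nz] : [/\ x != d, x != b & x != z].
    by move: xN; rewrite !inE !negb_or => /and3P.
  have /and3P[db bz dz] := t2.
  case: H => /and3P[h1 h2 _].
  - apply: (reach (displace (tperm z d) c1)).
    + by apply: (linked_slide (r := b)); rewrite // triR.
    + by rewrite hole_tperm.
    + by rewrite hole_tperm // adj_neq // adjC.
    + by rewrite hole_tpermL.
    + by rewrite !inE negb_or nb.
  - by apply: (reach c1); rewrite ?linked_refl // !inE negb_or nb.
  - apply: (reach (displace (tperm b d) c1)).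
    + by apply: (linked_slide (r := z)); rewrite // triC.
    + by rewrite hole_tperm.
    + by rewrite hole_tpermL.
    + by rewrite hole_tperm // eq_sym adj_neq.
    + by rewrite !inE negb_or nb.
move=> _ c1 hx [/and3P[_ _]|/and3P[hb hz _]|/and3P[_ _]].
- by rewrite inE eqxx.
- by exists x, b0, z0, c1; split; rewrite ?linked_refl // /vacant hx hb.
- by rewrite !inE eqxx orbT.
Qed.


Lemma non_isolatedP c : non_isolated c ->
  exists p q r, [/\ tri q r p, hole c q & hole c r].
Proof.
case=> c' /existsP[i /and4P[_ hq pq /existsP[r /and3P[hr pr qr]]]].
by exists (val c i), (val c' i), r; split=> //; rewrite -triR; apply/and3P.
Qed.

Lemma card_holes c : #|hole c| = #|{: B}| - (#|` B| - h).
Proof.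
have /injectiveP inj := valP c.
have := cardC (mem (codom (val c))); rewrite (card_codom inj) card_ord => <-.
by rewrite addKn; apply: eq_card => x.
Qed.

Theorem non_isolated_linked c c' : 2 < h <= #|` B| ->
  non_isolated c -> non_isolated c' -> linked c c'.
Proof.
move=> /andP[h3 hB].
have gather c0 : non_isolated c0 ->
    exists a b z c1, [/\ tri a b z, linked c0 c1 & vacant a b z c1].
  move=> /non_isolatedP[p [q [r [t hq hr]]]].
  have /existsP[x /andP[xN hx]] : [exists x, (x \notin [:: q; r]) && hole c0 x].
    have : ~~ (#|hole c0| <= size [:: q; r]).
      by rewrite card_holes -cardfE subKn // -ltnNge.
    apply: contraR => /existsPn all_in; apply: leq_trans (card_size [:: q; r]).
    apply/subset_leq_card/subsetP => x hx; have := all_in x.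
    by rewrite negb_and negbK => /orP[//|/negP[]].
  exact: linked_gather t xN hq hr hx.
move=> /gather[a [b [z [c1 [t L1 v1]]]]].
move=> /gather[a' [b' [z' [c1' [t' L1' v1']]]]].
have [c2 L2 v2] := linked_vacate t t' v1.
apply: (linked_trans L1); apply: (linked_trans L2).
rewrite linked_sym; apply: (linked_trans L1').
exact: linked_same_vacancy t' v1' v2.
Qed.

End Connectedness.

(** * Exchanges in a square of nine positions *)

Definition grid_adj (i j i' j' : nat) : bool :=
  [|| (i' == i.+1) && (j' == j), (i == i'.+1) && (j' == j),
      (i' == i) && (j' == j.+1), (i' == i) && (j == j'.+1),
      (i' == i.+1) && (j' == j.+1) | (i == i'.+1) && (j == j'.+1)].

(** The position in column x and row y of a 3 x 3 square has code x + 3 y: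
<<
  6 7 8
  3 4 5
  0 1 2
>>
The centre 4 is surrounded by the ring 0 1 5 8 7 3; the corners 2 and 6 are off
the ring. *)
Definition codes := iota 0 9.
Definition code_adj (k l : nat) : bool := grid_adj (k %% 3) (k %/ 3) (l %% 3) (l %/ 3).
Definition exchange (p q k : nat) : nat :=
  if k == p then q else if k == q then p else k.

(** [H] lists the holes known to the word, and the move [(p, q)] sends the tile on
[p] to [q]. *)
Definition legal (H : seq nat) (m : nat * nat) : bool :=
  [&& m.1 \in codes, m.1 \notin H, m.2 \in codes, m.2 \in H, code_adj m.1 m.2 &
      has (fun r => code_adj m.1 r && code_adj m.2 r) H].

Fixpoint legal_word (H : seq nat) (w : seq (nat * nat)) : bool :=
  if w is m :: w' then
    legal H m && legal_word [seq exchange m.1 m.2 k | k <- H] w'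
  else true.

Definition effect (w : seq (nat * nat)) (k : nat) : nat :=
  foldl (fun k m => exchange m.1 m.2 k) k w.

(** Nothing is asked about where the holes end: they are indistinguishable. *)
Definition swaps (H : seq nat) (x y : nat) (w : seq (nat * nat)) : bool :=
  legal_word H w &&
  all (fun k => (k \in H) || (effect w k == exchange x y k)) codes.

Definition renamed (f : nat -> nat) (w : seq (nat * nat)) :=
  [seq (f m.1, f m.2) | m <- w].
Definition undo (w : seq (nat * nat)) := rev [seq (m.2, m.1) | m <- w].
Definition conjugate (u w : seq (nat * nat)) := u ++ w ++ undo u.

(** The reflection in the diagonal through 0 and 8 and the half turn, which
generate the symmetries of the square that respect adjacency. *)
Definition mirror k := 3 * (k %% 3) + k %/ 3.
Definition half_turn k := 8 - k.

(** With 1, 4 and 5 vacant, exchanges the corner 2 and the position 0.  The four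
tiles of the ring advance by one step, so that the first of them comes beside
the corner; it steps aside into the centre, lets the corner tile enter the ring,
and returns to the ring on the other side of it; then the ring turns back, the
corner tile taking the place of the first one, which goes into the corner. *)
Definition corner_word : seq (nat * nat) :=
  [:: (0, 1); (3, 0); (7, 3); (8, 7);
      (1, 4); (2, 1); (4, 5);
      (7, 8); (3, 7); (0, 3); (1, 0);
      (5, 2)].

(** The reflection in the other diagonal fixes the vacant triangle and the corner,
and takes 0 to 8. *)
Definition reflected_corner_word := renamed (mirror \o half_turn) corner_word.

Definition ring k := nth 0 [:: 0; 1; 5; 8; 7; 3] (k %% 6).
(** Takes the vacant triangle formed by the centre and the ring positions [k] and
[k.+1] one step further round the centre. *)
Definition roll k := [:: (ring k.+2, ring k.+1); (ring k.+1, ring k)].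

(** With 1, 4 and 5 vacant, exchanges 0 and 8 by way of the corner 2. *)
Definition opposite_word := conjugate corner_word reflected_corner_word.

(** With 4, 5 and 8 vacant, exchanges 1 and 7 by way of the corner 2: rolled back
one step, the vacant triangle is beside the corner and the tile of 1 on 8; rolled
on by five steps, it is again beside the corner and the tile of 7 on 0. *)
Definition skew_word :=
  conjugate (conjugate (undo (roll 1)) reflected_corner_word)
            (conjugate (flatten [seq roll k | k <- iota 2 5]) corner_word).

(** Up to symmetry, the two positions facing a triangle in the square are those of
one of these three words. *)
Definition words :=
  [seq renamed f w | f <- [:: id; mirror; half_turn; mirror \o half_turn],
                     w <- [:: corner_word; opposite_word; skew_word]].

(** Here [z] is the vertex common to the sides that [d] and [e] face. *)
Definition flanks_check : bool :=
  all (fun z => let N := [seq k <- codes | code_adj k z] in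
    all (fun a => all (fun b =>
      let F := [seq d <- N | (d \notin [:: a; b; z]) &&
                             (code_adj d a || code_adj d b)] in
      all (fun d => all (fun e => has (swaps [:: a; b; z] d e) words)
        [seq e <- F | e != d]) F)
      [seq b <- N | code_adj a b]) N) codes.

Lemma flanks_checked : flanks_check.
Proof. by vm_compute. Qed.

(** Soundness of the computation, for a square embedded in a board. *)
Section Square.
Variables (B : {fset hexagon}) (h : nat) (cell_of : nat -> B).
Hypothesis cell_of_inj : {in codes &, injective cell_of}.
Hypothesis cell_of_adj :
  {in codes &, forall k l, code_adj k l -> adj (cell_of k) (cell_of l)}.
Implicit Types (c : config B h).

Definition run w c :=
  foldl (fun c m => displace (tperm (cell_of m.1) (cell_of m.2)) c) c w.

Lemma tperm_exchange p q k : p \in codes -> q \in codes -> k \in codes ->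
  tperm (cell_of p) (cell_of q) (cell_of k) = cell_of (exchange p q k).
Proof.
move=> hp hq hk; rewrite /exchange.
have [->|np] := eqVneq k p; first exact: tpermL.
have [->|nq] := eqVneq k q; first exact: tpermR.
rewrite tpermD //; apply/eqP => /cell_of_inj E.
  by case/eqP: np; rewrite E.
by case/eqP: nq; rewrite E.
Qed.

Lemma exchange_codes p q k : p \in codes -> q \in codes -> k \in codes ->
  exchange p q k \in codes.
Proof. by rewrite /exchange; case: ifP => // _; case: ifP. Qed.

Lemma linked_run H w c : {subset H <= codes} -> legal_word H w ->
  all (fun k => hole c (cell_of k)) H -> linked c (run w c).
Proof.
elim: w H c => [|[p q] w IHw] H c sub /=; first by rewrite linked_refl.
move=> /andP[/and5P[/= hp pN hq qin /andP[apq /hasP[r rin /andP[apr aqr]]]] lw] /allP vac.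
apply: (linked_trans (y := displace (tperm (cell_of p) (cell_of q)) c)).
  apply: (linked_slide (r := cell_of r)); [|exact: vac|exact: vac].
  by apply/and3P; split; apply: cell_of_adj => //; apply: sub.
apply: IHw lw _.
  by move=> _ /mapP[k kin ->]; apply: exchange_codes => //; apply: sub.
apply/allP => _ /mapP[k kin ->]; rewrite -tperm_exchange //; last exact: sub.
by rewrite hole_displace vac.
Qed.

Lemma val_run w c H i k : {subset H <= codes} -> legal_word H w -> k \in codes ->
  val c i = cell_of k -> val (run w c) i = cell_of (effect w k).
Proof.
elim: w H c k => [|[p q] w IHw] H c k sub //= /andP[/and5P[/= hp _ hq _ _] lw] hk E.
have hk' := exchange_codes hp hq hk.
apply: IHw lw hk' _; last by rewrite displaceE E tperm_exchange.
by move=> _ /mapP[l lin ->]; apply: exchange_codes => //; apply: sub.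
Qed.

Lemma val_run_out w c H i : {subset H <= codes} -> legal_word H w ->
  {in codes, forall k, val c i <> cell_of k} -> val (run w c) i = val c i.
Proof.
elim: w H c => [|[p q] w IHw] H c sub //= /andP[/and5P[/= hp _ hq _ _] lw] out.
have E : val (displace (tperm (cell_of p) (cell_of q)) c) i = val c i.
  by rewrite displaceE tpermD //; apply/eqP => E; [apply: (out p)|apply: (out q)].
rewrite (IHw _ _ _ lw) ?E //.
by move=> _ /mapP[l lin ->]; apply: exchange_codes => //; apply: sub.
Qed.

Lemma swaps_swappable a b z x y w : {subset [:: a; b; z] <= codes} ->
  x \in codes -> y \in codes -> swaps [:: a; b; z] x y w ->
  swappable h (cell_of a) (cell_of b) (cell_of z) (cell_of x) (cell_of y).
Proof.
move=> sub hx hy /andP[lw /allP eff] c /and3P[ha hb hz].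
have vac : all (fun k => hole c (cell_of k)) [:: a; b; z] by rewrite /= ha hb hz.
suff <- : run w c = displace (tperm (cell_of x) (cell_of y)) c.
  exact: linked_run vac.
apply: config_inj => i; rewrite displaceE.
have [/hasP[k hk /eqP E]|/hasPn out] :=
  boolP (has (fun k => val c i == cell_of k) codes).
  rewrite (val_run sub lw hk E) E tperm_exchange //.
  have /orP[kin|/eqP-> //] := eff _ hk.
  by have /holeP := allP vac _ kin; case/(_ i).
have out' : {in codes, forall k, val c i <> cell_of k}.
  by move=> k hk /eqP E; have := out _ hk; rewrite E.
rewrite (val_run_out sub lw out') tpermD //; apply/eqP => E.
  exact: (out' x).
exact: (out' y).
Qed.

Lemma square_flank a b z d e :
  {subset [:: a; b; z; d; e] <= codes} ->
  code_adj a z -> code_adj b z -> code_adj a b -> code_adj d z -> code_adj e z ->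
  d \notin [:: a; b; z] -> e \notin [:: a; b; z] ->
  code_adj d a || code_adj d b -> code_adj e a || code_adj e b ->
  swappable h (cell_of a) (cell_of b) (cell_of z) (cell_of d) (cell_of e).
Proof.
move=> sub az bz ab dz ez dN eN dab eab.
have [->|ned] := eqVneq e d; first exact: swappable_refl.
have [ha hb hz hd he] : [/\ a \in codes, b \in codes, z \in codes,
                            d \in codes & e \in codes].
  by split; apply: sub; rewrite !inE eqxx ?orbT.
have /allP/(_ z hz) := flanks_checked.
move=> /allP/(_ a); rewrite mem_filter az ha => /(_ isT).
move=> /allP/(_ b); rewrite !mem_filter ab bz hb => /(_ isT).
move=> /allP/(_ d); rewrite !mem_filter dN dab dz hd => /(_ isT).
move=> /allP/(_ e); rewrite !mem_filter ned eN eab ez he => /(_ isT) /hasP[w _].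
apply: swaps_swappable => //.
by move=> k kin; apply: sub; move: kin; rewrite !inE => /or3P[] ->; rewrite ?orbT.
Qed.

End Square.

(** * The parallelogram board *)

Section Parallelogram.
Variables (m1 m2 : nat).
Hypotheses (m1_ge3 : 2 < m1) (m2_ge3 : 2 < m2).
Let B := parallelogram m1 m2.

Lemma mem_parallelogram i j : ((Posz i, Posz j) \in B) = (i < m1) && (j < m2).
Proof.
apply/imfset2P/andP => [[i' ii [j' jj [-> ->]]]|[im jm]].
  by move: ii jj; rewrite /= !mem_iota.
by exists i; rewrite /= ?mem_iota //; exists j; rewrite /= ?mem_iota.
Qed.

Lemma origin_in : (Posz 0, Posz 0) \in B.
Proof. by rewrite mem_parallelogram; lia. Qed.

Definition cell (i j : nat) : B := insubd [` origin_in]%fset (Posz i, Posz j).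

Lemma val_cell i j : i < m1 -> j < m2 -> val (cell i j) = (Posz i, Posz j).
Proof. by move=> im jm; rewrite val_insubd mem_parallelogram im jm. Qed.

Lemma cellP (p : B) : exists i j, [/\ i < m1, j < m2 & p = cell i j].
Proof.
have /imfset2P[i ii [j jj E]] := valP p; move: ii jj; rewrite /= !mem_iota => im jm.
by exists i, j; split=> //; apply: val_inj; rewrite val_cell.
Qed.

Lemma cell_inj i j i' j' : i < m1 -> j < m2 -> i' < m1 -> j' < m2 ->
  cell i j = cell i' j' -> i = i' /\ j = j'.
Proof. by move=> im jm im' jm' /(congr1 val); rewrite !val_cell // => -[-> ->]. Qed.

Lemma card_parallelogram : #|` B| = m1 * m2.
Proof.
rewrite cardfE; pose f (u : 'I_m1 * 'I_m2) : B := cell u.1 u.2.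
have f_inj : injective f.
  by move=> [i j] [i' j'] /cell_inj[] //= E1 E2; congr pair; apply: val_inj.
have -> : m1 * m2 = #|{: 'I_m1 * 'I_m2}| by rewrite card_prod !card_ord.
rewrite -(card_codom f_inj); apply: eq_card => p; rewrite inE; apply/esym/codomP.
by have [i [j [im jm ->]]] := cellP p; exists (Ordinal im, Ordinal jm).
Qed.

Lemma adj_cell i j i' j' : i < m1 -> j < m2 -> i' < m1 -> j' < m2 ->
  adj (cell i j) (cell i' j') = grid_adj i j i' j'.
Proof.
move=> im jm im' jm'; rewrite /adj /hex_adj !val_cell // /grid_adj !inE !xpair_eqE /=.
lia.
Qed.

Definition square_cell (i j : nat) (k : nat) : B := cell (i + k %% 3) (j + k %/ 3).

Lemma code_lt k : k \in codes -> (k %% 3 < 3) && (k %/ 3 < 3).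
Proof. by rewrite mem_iota; lia. Qed.

Lemma square_cell_inj i j : i + 2 < m1 -> j + 2 < m2 ->
  {in codes &, injective (square_cell i j)}.
Proof.
move=> im jm k l /code_lt hk /code_lt hl /cell_inj; lia.
Qed.

Lemma square_cell_adj i j k l : i + 2 < m1 -> j + 2 < m2 ->
  k \in codes -> l \in codes ->
  adj (square_cell i j k) (square_cell i j l) = code_adj k l.
Proof.
move=> im jm /code_lt hk /code_lt hl; rewrite adj_cell; try lia.
by rewrite /code_adj /grid_adj; lia.
Qed.

(** A vertex common to two sides is adjacent to everything that faces them, so a
square containing the neighbourhood of a position contains all that is needed.
The truncated differences put the position in the middle of the square, or on
its edge if it is on the edge of the board. *)
Lemma square_around (z : B) : exists i j, [/\ i + 2 < m1, j + 2 < m2 &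
  forall p : B, adj p z || (p == z) -> exists2 k, k \in codes & p = square_cell i j k].
Proof.
have [x [y [xm ym ->]]] := cellP z.
exists (minn x.-1 (m1 - 3)), (minn y.-1 (m2 - 3)); split; try lia.
move=> p; have [x' [y' [xm' ym' ->]]] := cellP p => near.
have {near} [nx ny] : x' <= x.+1 /\ x <= x'.+1 /\ y' <= y.+1 /\ y <= y'.+1.
  move: near => /orP[|/eqP/cell_inj[] //]; last by lia.
  by rewrite adj_cell // /grid_adj; lia.
exists (3 * (y' - minn y.-1 (m2 - 3)) + (x' - minn x.-1 (m1 - 3))).
  by rewrite mem_iota; lia.
rewrite /square_cell; congr cell; lia.
Qed.

Lemma tri_cell i j i' j' i'' j'' : i < m1 -> j < m2 -> i' < m1 -> j' < m2 ->
  i'' < m1 -> j'' < m2 -> tri (cell i j) (cell i' j') (cell i'' j'') =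
  [&& grid_adj i j i' j', grid_adj i' j' i'' j'' & grid_adj i j i'' j''].
Proof. by move=> *; rewrite /tri !adj_cell. Qed.

Lemma parallelogram_triangles_cover : triangles_cover B.
Proof.
move=> p; have [i [j [im jm ->]]] := cellP p.
have [i_lt|i_ge] := ltnP i.+1 m1; have [j_lt|j_ge] := ltnP j.+1 m2.
- by exists (cell i.+1 j), (cell i.+1 j.+1); rewrite tri_cell // /grid_adj; lia.
- by exists (cell i j.-1), (cell i.+1 j); rewrite tri_cell ?/grid_adj; lia.
- by exists (cell i.-1 j), (cell i j.+1); rewrite tri_cell ?/grid_adj; lia.
- by exists (cell i j.-1), (cell i.-1 j.-1); rewrite tri_cell ?/grid_adj; lia.
Qed.

(** Sorted by the sum of their coordinates, the vertices of a triangle are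
(x, y), then (x + 1, y) or (x, y + 1), then (x + 1, y + 1). *)
Lemma tri_cell_ind (P : B -> B -> B -> Prop) :
  (forall a b z, P a b z -> P b a z) ->
  (forall a b z, P a b z -> P b z a) ->
  (forall x y, x.+1 < m1 -> y.+1 < m2 ->
     P (cell x y) (cell x.+1 y) (cell x.+1 y.+1)) ->
  (forall x y, x.+1 < m1 -> y.+1 < m2 ->
     P (cell x y) (cell x y.+1) (cell x.+1 y.+1)) ->
  forall a b z, tri a b z -> P a b z.
Proof.
move=> PC PR PU PD a b z.
have [i [j [im jm ->]]] := cellP a; have [i' [j' [im' jm' ->]]] := cellP b.
have [i'' [j'' [im'' jm'' ->]]] := cellP z; move=> t.
have sorted x y x' y' x'' y'' : x < m1 -> y < m2 -> x' < m1 -> y' < m2 ->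
    x'' < m1 -> y'' < m2 -> x + y < x' + y' -> x' + y' < x'' + y'' ->
    tri (cell x y) (cell x' y') (cell x'' y'') ->
    P (cell x y) (cell x' y') (cell x'' y'').
  move=> xm ym xm' ym' xm'' ym'' lt1 lt2; rewrite tri_cell // /grid_adj => t'.
  have [E1 E2] : x'' = x.+1 /\ y'' = y.+1 by lia.
  rewrite E1 E2 in xm'' ym'' t' *.
  have [[-> ->]|[-> ->]] : (x' = x.+1 /\ y' = y) \/ (x' = x /\ y' = y.+1) by lia.
    exact: PU.
  exact: PD.
have [ne1 ne2 ne3] : [/\ i + j <> i' + j', i' + j' <> i'' + j'' & i + j <> i'' + j''].
  by have := t; rewrite tri_cell // /grid_adj => /and3P[t1 t2 t3]; split; lia.
have t1 := t; rewrite triC in t1; have t2 := t; rewrite triR in t2.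
have t3 := t2; rewrite triR in t3; have t4 := t1; rewrite triR in t4.
have t5 := t4; rewrite triR in t5.
have [lt1|ge1] := ltnP (i + j) (i' + j'); have [lt2|ge2] := ltnP (i' + j') (i'' + j'');
  have [lt3|ge3] := ltnP (i + j) (i'' + j''); try lia.
- exact: sorted.
- by apply: PR; apply: PC; apply: sorted => //; lia.
- by apply: PR; apply: sorted => //; lia.
- by apply: PC; apply: sorted => //; lia.
- by apply: (PR); apply: PR; apply: sorted => //; lia.
- by apply: PC; apply: PR; apply: sorted => //; lia.
Qed.

(** [U x y] and [D x y] speak of the two halves of the unit square at (x, y).  These
share its diagonal, and each shares a side with a half of a neighbouring unit
square, so that all are joined to the halves at the origin. *)
Lemma parallelogram_triangles_connected : triangles_connected B.
Proof.
move=> P PC PR PF a b z a' b' z' t t' Pabz.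
pose U x y := P (cell x y) (cell x.+1 y) (cell x.+1 y.+1).
pose D x y := P (cell x y) (cell x y.+1) (cell x.+1 y.+1).
have PFi a1 b1 z1 d1 : tri a1 b1 z1 -> tri d1 b1 z1 -> P a1 b1 z1 <-> P d1 b1 z1.
  by move=> t1 t2; split; apply: PF.
have PCi a1 b1 z1 : P a1 b1 z1 <-> P b1 a1 z1 by split; apply: PC.
have PRi a1 b1 z1 : P a1 b1 z1 <-> P b1 z1 a1 by split=> [|/PR/PR]; [apply: PR|].
have UD x y : x.+1 < m1 -> y.+1 < m2 -> U x y <-> D x y.
  move=> xm ym; apply: iff_trans (PCi _ _ _) (iff_trans _ (PCi _ _ _)).
  by apply: PFi; rewrite tri_cell ?/grid_adj; lia.
have UDx x y : x.+2 < m1 -> y.+1 < m2 -> U x y <-> D x.+1 y.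
  move=> xm ym; apply: iff_trans (iff_trans _ (PRi _ _ _)) (iff_refl _).
  by apply: PFi; rewrite tri_cell ?/grid_adj; lia.
have DUy x y : x.+1 < m1 -> y.+2 < m2 -> D x y <-> U x y.+1.
  move=> xm ym; apply: iff_trans (iff_trans _ (PRi _ _ _)) (iff_refl _).
  by apply: PFi; rewrite tri_cell ?/grid_adj; lia.
have U0 x y : x.+1 < m1 -> y.+1 < m2 -> U x y <-> U 0 0.
  elim: y => [|y IHy] xm ym.
    elim: x xm => [//|x IHx] xm; apply: iff_trans (IHx _); last by lia.
    by apply: iff_trans (UD _ _ _ _) (iff_sym (UDx _ _ _ _)).
  apply: iff_trans (IHy xm _); last by lia.
  by apply: iff_trans (iff_sym (DUy _ _ _ _)) (iff_sym (UD _ _ _ _)) => //; lia.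
have P0 : U 0 0.
  apply: (tri_cell_ind (P := fun a b z => P a b z -> U 0 0)) t Pabz.
  - by move=> a1 b1 z1 IH H; apply: IH; apply: PC.
  - by move=> a1 b1 z1 IH H; apply: IH; apply/PRi.
  - by move=> x y xm ym /(U0 _ _ xm ym).
  - by move=> x y xm ym /(UD _ _ xm ym)/(U0 _ _ xm ym).
apply: tri_cell_ind t' => //.
- by move=> x y xm ym; apply/(U0 _ _ xm ym).
- by move=> x y xm ym; apply/(UD _ _ xm ym)/(U0 _ _ xm ym).
Qed.

(** Two sides of a triangle have a vertex in common; a square around that vertex
contains the triangle and both facing positions. *)
Lemma parallelogram_flanks_swappable h : flanks_swappable B h.
Proof.
move=> a b z d e t /andP[dN Fd] /andP[eN Fe].
pose center p q r := [&& adj d r, adj e r, adj d p || adj d q & adj e p || adj e q].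
have at_center p q r : tri p q r -> d \notin [:: p; q; r] -> e \notin [:: p; q; r] ->
    center p q r -> swappable h p q r d e.
  move=> /and3P[pq qr pr] dN' eN' /and4P[dr er dpq epq].
  have [i [j [im jm near]]] := square_around r.
  have [kr hr Er] : exists2 k, k \in codes & r = square_cell i j k.
    by apply: near; rewrite eqxx orbT.
  have near' s : adj s r -> exists2 k, k \in codes & s = square_cell i j k.
    by move=> sr; apply: near; rewrite sr.
  have [[kp hp Ep] [kq hq Eq]] := (near' _ pr, near' _ qr).
  have [[kd hd Ed] [ke he Ee]] := (near' _ dr, near' _ er).
  have code_notin k :
      square_cell i j k \notin [:: p; q; r] -> k \notin [:: kp; kq; kr].
    by apply: contraNN; rewrite Er Ep Eq !inE => /or3P[]/eqP->; rewrite eqxx ?orbT.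
  move: pq qr pr dr er dpq epq; rewrite Er Ep Eq Ed Ee !square_cell_adj //.
  move=> pq qr pr dr er dpq epq.
  apply: square_flank => //.
  - exact: square_cell_inj.
  - by move=> k l hk hl kl; rewrite square_cell_adj.
  - by move=> k; rewrite 4!in_cons mem_seq1 => /or4P[|||/orP[]] /eqP ->.
  - by apply: code_notin; rewrite -Ed.
  - by apply: code_notin; rewrite -Ee.
have rot3 p q r s : s \notin [:: p; q; r] -> s \notin [:: q; r; p].
  by rewrite !inE orbC -orbA.
have : [|| center a b z, center b z a | center z a b].
  move: Fd Fe; rewrite /center; case: (adj d a); case: (adj d b); case: (adj d z);
    by case: (adj e a); case: (adj e b); case: (adj e z).
case/or3P=> C.
- exact: at_center.
- apply: swappableR; apply: swappableR; apply: at_center => //; first by rewrite -triR.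
    exact: rot3.
  exact: rot3.
- apply: swappableR; apply: at_center => //; first by rewrite triR.
    by do 2 apply: (rot3).
  by do 2 apply: (rot3).
Qed.

(** A tile on [p], with [q] and [r] left vacant; the others are anywhere else. *)
Lemma exists_non_isolated h :
  2 < h -> h < m1 * m2 -> exists c : config B h, non_isolated c.
Proof.
move=> h3 hm.
pose p := cell 0 0; pose q := cell 1 0; pose r := cell 1 1.
have t : tri p q r by rewrite tri_cell // /grid_adj; lia.
have /and3P[pq qr pr] := t.
have le : #|` B| - h.+1 <= #|[predC mem [:: p; q; r]]|.
  have := cardC (mem [:: p; q; r]); rewrite -cardfE => E.
  have le3 : #|mem [:: p; q; r]| <= 3 := card_size [:: p; q; r].
  by rewrite -E leq_subLR leq_add2r (leq_trans le3) // ltnW.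
have /card_geqP[s [s_uniq s_size s_sub]] := le.
have s_out x : x \in [:: p; q; r] -> x \notin s.
  by move=> xin; apply/negP => /s_sub; rewrite inE /= xin.
have sz : size (p :: s) = #|` B| - h by rewrite /= s_size subnSK // card_parallelogram.
have inj : injectiveb [ffun i : 'I_(#|` B| - h) => nth p (p :: s) i].
  apply/injectiveP => i j; rewrite !ffunE => /eqP.
  rewrite nth_uniq ?sz ?ltn_ord //; first by move/eqP/val_inj.
  by rewrite /= s_uniq s_out // inE eqxx.
pose c : config B h :=
  exist (fun f : {ffun 'I_(#|` B| - h) -> B} => is_true (injectiveb f)) _ inj.
exists c, (displace (tperm p q) c).
have vc i : val c i = nth p (p :: s) i by rewrite ffunE.
have hole_c x : x \in [:: q; r] -> hole c x.
  move=> xin; apply/holeP => i; rewrite vc => E.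
  have : x \in p :: s by rewrite -E mem_nth // sz.
  rewrite inE (negPf (s_out x _)) ?orbF; last by rewrite inE xin orbT.
  move: xin; rewrite !inE => /orP[] /eqP->; rewrite eq_sym; apply/negP.
    exact: adj_neq.
  exact: adj_neq.
have hq : hole c q by apply: hole_c; rewrite inE eqxx.
have hr : hole c r by apply: hole_c; rewrite !inE eqxx orbT.
have n_gt0 : 0 < #|` B| - h by rewrite -sz.
have [i Ei] : exists i, val c i = p by exists (Ordinal n_gt0); rewrite vc.
apply/existsP; exists i; rewrite displaceE Ei tpermL hq.
apply/and4P; split=> //; last by apply/existsP; exists r; apply/and3P; split.
apply/forallP => j; apply/implyP => nji; rewrite displaceE tpermD //; last first.
  by apply/eqP => E; move/holeP: hq => /(_ j); rewrite E.
apply: contraNneq nji => E; apply/eqP; have /injectiveP := valP c; apply.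
by rewrite Ei.
Qed.

End Parallelogram.

Theorem theorem1p3 (m1 m2 h : nat) :
  (3 <= m1)%N -> (3 <= m2)%N -> (3 <= h)%N -> (h < m1 * m2)%N ->
  maximally_connected (parallelogram m1 m2) h.
Proof.
move=> m1_ge3 m2_ge3 h_ge3 h_lt; split; first exact: exists_non_isolated.
move=> c c'; apply: non_isolated_linked.
- exact: parallelogram_triangles_connected.
- exact: parallelogram_triangles_cover.
- exact: parallelogram_flanks_swappable.
by rewrite h_ge3 card_parallelogram // ltnW.
Qed.
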